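(* The involution length of $\mathrm{PU}(2,1)$ is $4$. That is, every element of $\mathrm{PU}(2,1)$ is a product of at most $4$ involutions of $\mathrm{PU}(2,1)$, and there exists an element of $\mathrm{PU}(2,1)$ which is not a product of at most $3$ involutions of $\mathrm{PU}(2,1)$.
   Context: $\mathrm{U}(2,1)\subset \mathrm{GL}(3,\mathbb{C})$ is the unitary group of a Hermitian form of signature $(2,1)$ on $\mathbb{C}^3$, and $\mathrm{PU}(2,1)$ is its image in $\mathrm{PGL}(3,\mathbb{C})$ (the group of holomorphic isometries of the complex hyperbolic plane). An involution is an element of order $2$ of $\mathrm{PU}(2,1)$. The involution length of a group is the smallest $n\in\mathbb{N}$ such that every element of the group is a product of at most $n$ involutions of the group. *)

(* Defs.v *)
From HB Require Import structures.
From mathcomp Require Import all_boot all_order all_algebra.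
From mathcomp Require Import boolp reals complex.

Set Implicit Arguments.
Unset Strict Implicit.
Unset Printing Implicit Defensive.

Import Order.TTheory GRing.Theory Num.Theory.

Local Open Scope ring_scope.
Local Open Scope quotient_scope.
Local Open Scope sesquilinear_scope.

Section GeneralLinearGroup.
Variables (F : fieldType) (n : nat).

Record GL := MkGL { gl_mx :> 'M[F]_n; gl_unit : gl_mx \in unitmx }.

HB.instance Definition _ := [isSub for gl_mx].
HB.instance Definition _ := [Choice of GL by <:].

Definition gl_one : GL := MkGL (unitmx1 F n).

Fact gl_mul_subproof (A B : GL) : (A *m B : 'M[F]_n) \in unitmx.
Proof. by rewrite unitmx_mul !gl_unit. Qed.
Definition gl_mul (A B : GL) : GL := MkGL (gl_mul_subproof A B).

Fact gl_inv_subproof (A : GL) : invmx A \in unitmx.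
Proof. by rewrite unitmx_inv gl_unit. Qed.
Definition gl_inv (A : GL) : GL := MkGL (gl_inv_subproof A).

Fact gl_mulA : associative gl_mul.
Proof. by move=> A B D; apply/val_inj/mulmxA. Qed.
Fact gl_mul1 : left_id gl_one gl_mul.
Proof. by move=> A; apply/val_inj/mul1mx. Qed.
Fact gl_mulr1 : right_id gl_one gl_mul.
Proof. by move=> A; apply/val_inj/mulmx1. Qed.
Fact gl_mulV : left_inverse gl_one gl_inv gl_mul.
Proof. by move=> A; apply/val_inj/mulVmx/gl_unit. Qed.
Fact gl_mulrV : right_inverse gl_one gl_inv gl_mul.
Proof. by move=> A; apply/val_inj/mulmxV/gl_unit. Qed.

HB.instance Definition _ :=
  isGroup.Build GL gl_mulA gl_mul1 gl_mulr1 gl_mulV gl_mulrV.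

(* Congruence modulo the subgroup of scalar matrices, i.e. the center. *)
Definition proj_eq : rel GL := fun A B => is_scalar_mx (A *m invmx B).

Lemma proj_eqP (A B : GL) :
  reflect (exists c : F, (A : 'M[F]_n) = c *: (B : 'M[F]_n)) (proj_eq A B).
Proof.
apply: (iffP is_scalar_mxP) => -[c Ec]; exists c.
  by rewrite -mul_scalar_mx -Ec mulmxKV ?gl_unit.
by rewrite Ec -scalemxAl mulmxV ?gl_unit // scalemx1.
Qed.

Fact proj_eq_refl : reflexive proj_eq.
Proof. by move=> A; apply/proj_eqP; exists 1; rewrite scale1r. Qed.

Fact proj_eq_sym : symmetric proj_eq.
Proof.
suff sym A B : proj_eq A B -> proj_eq B A by move=> A B; apply/idP/idP; apply: sym.
case/proj_eqP => c Ec; apply/proj_eqP; have [c0|c0] := eqVneq c 0.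
  have M0 (M : 'M[F]_n) : M = 0.
    by rewrite -[M](mulmxK (gl_unit A)) -mulmxA Ec c0 scale0r mul0mx mulmx0.
  by exists 1; rewrite (M0 B) (M0 A) scaler0.
by exists c^-1; rewrite Ec scalerA mulVf // scale1r.
Qed.

Fact proj_eq_trans : transitive proj_eq.
Proof.
move=> B A D /proj_eqP[c Ec] /proj_eqP[d Ed]; apply/proj_eqP.
by exists (c * d); rewrite Ec Ed scalerA.
Qed.

Canonical proj_eq_equiv := EquivRel proj_eq proj_eq_refl proj_eq_sym proj_eq_trans.

Definition PGL := {eq_quot proj_eq}.

HB.instance Definition _ := Choice.on PGL.
HB.instance Definition _ := EqQuotient.on PGL.

Definition pgl_proj (A : GL) : PGL := \pi_PGL A.

Definition pgl_one : PGL := pgl_proj gl_one.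
Definition pgl_mul (x y : PGL) : PGL := pgl_proj (gl_mul (repr x) (repr y)).
Definition pgl_inv (x : PGL) : PGL := pgl_proj (gl_inv (repr x)).

Lemma pgl_projP (A B : GL) :
  pgl_proj A = pgl_proj B <-> exists c : F, (A : 'M[F]_n) = c *: (B : 'M[F]_n).
Proof.
split=> [/eqmodP/proj_eqP // | Ec]; apply/eqmodP; exact/proj_eqP.
Qed.

Lemma pgl_projK (x : PGL) : pgl_proj (repr x) = x.
Proof. exact: reprK. Qed.

Lemma pgl_mul_proj (A B : GL) :
  pgl_mul (pgl_proj A) (pgl_proj B) = pgl_proj (gl_mul A B).
Proof.
have /pgl_projP[c Ec] := pgl_projK (pgl_proj A).
have /pgl_projP[d Ed] := pgl_projK (pgl_proj B).
apply/pgl_projP; exists (c * d).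
by rewrite /= Ec Ed -scalemxAl -scalemxAr scalerA.
Qed.

Fact pgl_mulA : associative pgl_mul.
Proof.
move=> x y z; rewrite -[x]pgl_projK -[y]pgl_projK -[z]pgl_projK.
by rewrite !pgl_mul_proj gl_mulA.
Qed.
Fact pgl_mul1 : left_id pgl_one pgl_mul.
Proof. by move=> x; rewrite -[x]pgl_projK pgl_mul_proj gl_mul1. Qed.
Fact pgl_mulr1 : right_id pgl_one pgl_mul.
Proof. by move=> x; rewrite -[x]pgl_projK pgl_mul_proj gl_mulr1. Qed.
Fact pgl_mulV : left_inverse pgl_one pgl_inv pgl_mul.
Proof. by move=> x; rewrite -{2}[x]pgl_projK pgl_mul_proj gl_mulV. Qed.
Fact pgl_mulrV : right_inverse pgl_one pgl_inv pgl_mul.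
Proof. by move=> x; rewrite -{1}[x]pgl_projK pgl_mul_proj gl_mulrV. Qed.

HB.instance Definition _ :=
  isGroup.Build PGL pgl_mulA pgl_mul1 pgl_mulr1 pgl_mulV pgl_mulrV.

Lemma pgl_projM (A B : GL) : pgl_proj (A * B)%g = (pgl_proj A * pgl_proj B)%g.
Proof. exact/esym/pgl_mul_proj. Qed.

Lemma pgl_proj1 : pgl_proj 1%g = 1%g.
Proof. by []. Qed.

Lemma pgl_projV (A : GL) : pgl_proj A^-1%g = (pgl_proj A)^-1%g.
Proof.
by apply: (mulIg (pgl_proj A)); rewrite -pgl_projM !mulVg pgl_proj1.
Qed.

End GeneralLinearGroup.

Section UnitaryGroup.
Variables (C : numClosedFieldType) (n : nat).

(* H is the Gram matrix of the form <v, w> = w^* H v on column vectors.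
   The number of positive and negative vectors in an orthogonal basis (the
   columns of P) does not depend on the basis; 0 < z implies z real in C. *)
Definition has_signature (H : 'M[C]_n) (p q : nat) : Prop :=
  exists (P : 'M[C]_n) (d : 'rV[C]_n),
    [/\ P \in unitmx, P^t* *m H *m P = diag_mx d,
        #|[set i | 0 < d 0 i]| = p & #|[set i | d 0 i < 0]| = q].

Definition unitary_group (H : 'M[C]_n) : {pred GL C n} :=
  [pred A : GL C n | (A : 'M[C]_n)^t* *m H *m A == H].

Fact unitary_group_closed (H : 'M[C]_n) : group_closed (unitary_group H).
Proof.
have conjM (A B : 'M[C]_n) : (A *m B)^t* = B^t* *m A^t*.
  by rewrite trmx_mul map_mxM.
split=> [|A B]; rewrite !inE /=.
  by rewrite trmx1 map_mx1 mul1mx mulmx1.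
move=> /eqP uA /eqP uB; apply/eqP.
have uBV : (invmx B)^t* *m H *m invmx B = H.
  rewrite -{1}uB -!mulmxA mulmxV ?gl_unit // mulmx1 mulmxA -conjM.
  by rewrite mulmxV ?gl_unit // trmx1 map_mx1 mul1mx.
by rewrite conjM -!mulmxA [_ *m (H *m _)]mulmxA [_ *m (A *m _)]mulmxA uA mulmxA uBV.
Qed.

Definition PU_pred (H : 'M[C]_n) : {pred PGL C n} :=
  fun x => `[< exists2 A : GL C n, A \in unitary_group H & x = pgl_proj A >].

Fact PU_closed (H : 'M[C]_n) : group_closed (PU_pred H).
Proof.
have [U1 UV] := unitary_group_closed H.
split=> [|x y]; first by apply/asboolP; exists 1%g.
move=> /asboolP[A uA ->] /asboolP[B uB ->]; apply/asboolP.
by exists (A / B)%g; rewrite ?UV // pgl_projM pgl_projV.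
Qed.

Definition PU (H : 'M[C]_n) : Type := {x : PGL C n | PU_pred H x}.

HB.instance Definition _ (H : 'M[C]_n) := SubChoice.on (PU H).
HB.instance Definition _ (H : 'M[C]_n) :=
  SubChoice_isSubGroup.Build (PGL C n) (PU_pred H) (PU H) (PU_closed H).

End UnitaryGroup.

Section InvolutionLength.
Variable G : groupType.

Definition involution (x : G) : bool := (x != 1)%g && (x ^+ 2 == 1)%g.

Definition prod_of_involutions (k : nat) (x : G) : Prop :=
  exists s : seq G,
    [/\ (size s <= k)%N, all involution s & x = (\prod_(y <- s) y)%g].

Definition has_involution_length (k : nat) : Prop :=
  (forall x : G, prod_of_involutions k x) /\
  (forall m : nat, (forall x : G, prod_of_involutions m x) -> (k <= m)%N).

End InvolutionLength.

(* Main.v *)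
Require Import Defs.
From mathcomp Require Import all_boot all_order all_algebra.
From mathcomp Require Import boolp reals complex ring.

(** Write <x, y> = y^* H x.  Rescaling a lift of an involution of PU(2,1) turns
it into a unitary involution other than 1 and -1; one of its two eigenspaces is
a nonisotropic line, so up to sign it is the reflection R_v, which maps v to -v
and fixes the orthogonal of v.  The question is therefore which unitary matrices
are, up to a scalar, products of few reflections R_v.  The basic tool is that
R_(x-u) exchanges two isotropic vectors x and u as soon as <x, u> is real and
nonzero.

_Four reflections suffice._  Let U have determinant 1 and isotropic eigenvector
x, with a real eigenvalue r other than 1 and -1.  Then U has a second isotropic
eigenvector y, with eigenvalue 1/r, and fixes the orthogonal of x and y.  When y
is scaled so that <x, y> = 1, R_(x-y) exchanges x and y, and R_(y-rx) exchanges
y and r x, so U is the product of R_(y-rx) and R_(x-y)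
([real_eigenvalue_two_reflections]).  Now let A have determinant 1 without being
scalar, and let x be an isotropic vector that is not an eigenvector of A.  There
is an isotropic u for which both <x, u> and <A x, u> are real and nonzero, so
that one reflection carries A x to u/2 and another one carries u to x.
Multiplying A on the left by these two reflections produces a matrix with
eigenvalue 1/2 at x, to which the first step applies ([four_reflections]).

_Three do not._  Let A be the complex reflection that multiplies a negative
vector n by k and fixes the orthogonal of n, where |k| = 1, k is not real and
Re k < 0.  Suppose that A = c R_1 R_2 R_3; then |c| = 1, and c^3 = k or
c^3 = -k by taking determinants, so that c is not real.  A vector w orthogonal
to n and v_3 is positive, and R_1 R_2 w = c^* w; then R_1 w is positive too,
with eigenvalue c.  A vector u orthogonal to v_1 and v_2 is fixed by R_1 R_2, hence
orthogonal to w and R_1 w, and the signature forces u to be negative.  Finally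
R_3 u = c A^-1 u and <R_3 u, u> is real.  Written out, this says that
<u, u> <n, n> = |<u, n>|^2 (1 + s) with s = 2 Re c or s = -2 Re c, according to
the sign above, and the reversed Cauchy-Schwarz inequality for u and n yields
-1 < s <= 0.  But then 2 Re k = s (s^2 - 3) >= 0 ([not_three_reflections]).
Products of fewer than three involutions are covered by the same argument, in
which each R_i is allowed to be the identity. *)

Set Implicit Arguments.
Unset Strict Implicit.
Unset Printing Implicit Defensive.

Import Order.TTheory GRing.Theory Num.Theory.

Local Open Scope ring_scope.
Local Open Scope sesquilinear_scope.

(** * Hermitian forms and complex reflections *)

Lemma mulmx_ext (K : fieldType) n (U V : 'M[K]_n) :
  (forall x : 'cV_n, U *m x = V *m x) -> U = V.
Proof.
move=> eqUV; apply/trmx_inj/row_matrixP => i; rewrite -!tr_col; congr _^T.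
by rewrite !colE eqUV.
Qed.

Section HermitianForm.
Variables (C : numClosedFieldType) (n : nat) (H : 'M[C]_n).
Implicit Types (x y v : 'cV[C]_n) (a b k : C) (U V : 'M[C]_n).

Definition hform x y : C := (y^t* *m H *m x) 0 0.

Definition isometry U := forall x y, hform (U *m x) (U *m y) = hform x y.

Lemma hformDl x x' y : hform (x + x') y = hform x y + hform x' y.
Proof. by rewrite /hform mulmxDr mxE. Qed.
Lemma hformZl a x y : hform (a *: x) y = a * hform x y.
Proof. by rewrite /hform -scalemxAr mxE. Qed.
Lemma hformNl x y : hform (- x) y = - hform x y.
Proof. by rewrite -scaleN1r hformZl mulN1r. Qed.
Lemma hformDr x y y' : hform x (y + y') = hform x y + hform x y'.
Proof. by rewrite /hform raddfD map_mxD !mulmxDl mxE. Qed.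
Lemma hformZr a x y : hform x (a *: y) = a^* * hform x y.
Proof. by rewrite /hform linearZ /= map_mxZ -!scalemxAl mxE. Qed.
Lemma hformNr x y : hform x (- y) = - hform x y.
Proof. by rewrite -scaleN1r hformZr rmorphN rmorph1 mulN1r. Qed.
Lemma hform0l y : hform 0 y = 0.
Proof. by rewrite /hform mulmx0 mxE. Qed.

Definition hformE := (hformDl, hformDr, hformNl, hformNr, hformZl, hformZr).

Lemma isometryP U : isometry U <-> U^t* *m H *m U = H.
Proof.
split=> [isoU | isoU x y]; last first.
  by rewrite /hform -[in RHS]isoU trmx_mul map_mxM /= !mulmxA.
have entry (M : 'M[C]_n) i j :
    M i j = ((delta_mx i 0 : 'cV_n)^t* *m M *m (delta_mx j 0 : 'cV_n)) 0 0.
  by rewrite trmx_delta map_delta_mx -rowE -colE !mxE.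
apply/matrixP => i j; rewrite entry [RHS]entry -[RHS]isoU /hform.
by rewrite trmx_mul map_mxM /= !mulmxA.
Qed.

Lemma isometryM U V : isometry U -> isometry V -> isometry (U *m V).
Proof. by move=> isoU isoV x y; rewrite -!mulmxA isoU isoV. Qed.

Lemma isometryZ a U : `|a| = 1 -> isometry U -> isometry (a *: U).
Proof.
move=> a1 isoU x y; rewrite -!scalemxAl !hformE isoU mulrA -normCK.
by rewrite a1 expr1n mul1r.
Qed.

(** The complex reflection of ratio k: it multiplies v by k and fixes the
    orthogonal of v.  Ratio -1 gives the reflections R_v, and ratio 1 the
    identity. *)
Definition crefl v k : 'M[C]_n :=
  1%:M + ((k - 1) / hform v v) *: (v *m (v^t* *m H)).

Lemma mul_crefl v k x :
  crefl v k *m x = x + ((k - 1) * hform x v / hform v v) *: v.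
Proof.
rewrite /crefl mulmxDl mul1mx -scalemxAl -mulmxA [_ *m x]mx11_scalar.
by rewrite mul_mx_scalar scalerA -/(hform x v) mulrAC.
Qed.

Lemma crefl_orth v k x : hform x v = 0 -> crefl v k *m x = x.
Proof. by move=> xv; rewrite mul_crefl xv mulr0 mul0r scale0r addr0. Qed.

Lemma crefl_id v k : hform v v != 0 -> crefl v k *m v = k *: v.
Proof.
move=> v0; rewrite mul_crefl mulfK // -[X in X + _]scale1r -scalerDl.
by rewrite addrC subrK.
Qed.

Lemma creflM v k l :
  hform v v != 0 -> crefl v k *m crefl v l = crefl v (k * l).
Proof.
move=> v0; apply: mulmx_ext => x; rewrite -mulmxA !mul_crefl !hformE.
rewrite -addrA -scalerDl; congr (_ + _ *: _).
by field.
Qed.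

Lemma crefl1 v : crefl v 1 = 1%:M.
Proof. by rewrite /crefl subrr mul0r scale0r addr0. Qed.

(** An instance of Sylvester's identity det (1 + v r) = 1 + r v, which follows
    from two triangular factorizations of the same block matrix. *)
Lemma det_crefl v k : hform v v != 0 -> \det (crefl v k) = k.
Proof.
move=> v0; set r : 'rV_n := ((k - 1) / hform v v) *: (v^t* *m H).
have -> : crefl v k = 1%:M + v *m r by rewrite /crefl /r -scalemxAr.
pose L := block_mx (1%:M : 'M[C]_1) (0 : 'M_(1, n)) v 1%:M.
have E : L *m block_mx (1%:M : 'M_1) (- r) 0 (1%:M + v *m r) =
         block_mx (1%:M + r *m v) (- r) 0 1%:M *m L.
  rewrite !mulmx_block !mul1mx !mulmx1 !mul0mx !mulmx0 !addr0 !add0r.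
  by rewrite mulNmx addrK mulmxN addrCA addNr addr0.
have := congr1 determinant E; rewrite !det_mulmx !det_ublock !det_lblock.
rewrite !det1 !mulr1 !mul1r => ->; rewrite [_ + _]mx11_scalar det_scalar1.
rewrite /r -scalemxAl mxE [X in X + _]mxE [X in _ + X]mxE -/(hform v v).
by rewrite divfK // addrC subrK.
Qed.

Hypothesis herm : H \is hermsymmx.

Lemma hformC x y : hform y x = (hform x y)^*.
Proof.
have HC : H^t* = H.
  by have /is_hermitianmxP := herm; rewrite expr0 scale1r => <-.
rewrite /hform; suff -> : y^t* *m H *m x = (x^t* *m H *m y)^t*.
  by rewrite [X in X^*]mxE conjCK [RHS]mxE.
by rewrite trmx_mul map_mxM trmx_mul map_mxM /= trmxCK HC mulmxA.
Qed.

Lemma hform_real x : (hform x x)^* = hform x x.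
Proof. by rewrite -hformC. Qed.

Lemma crefl_isometry v k : `|k| = 1 -> hform v v != 0 -> isometry (crefl v k).
Proof.
move=> k1 v0 x y; rewrite !mul_crefl !hformE !rmorphM /= fmorphV /= hform_real.
rewrite [hform v y]hformC rmorphB rmorph1.
have kk : k * k^* = 1 by rewrite -normCK k1 expr1n.
apply/eqP; rewrite -subr_eq0; apply/eqP.
transitivity ((k * k^* - 1) * hform x v * (hform y v)^* / hform v v).
  by field.
by rewrite kk subrr !mul0r.
Qed.

Lemma crefl_selfadj v k x : k^* = k ->
  (hform (crefl v k *m x) x)^* = hform (crefl v k *m x) x.
Proof.
move=> kR; rewrite mul_crefl !hformE rmorphD !rmorphM /= fmorphV /= !hform_real.
rewrite [hform v x]hformC conjCK rmorphB rmorph1 /= kR; congr (_ + _).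
by rewrite mulrAC -!mulrA; congr (_ * _); rewrite mulrC -mulrA.
Qed.

End HermitianForm.

(** * Bases of a three-dimensional space *)

Section ThreeVectors.
Variable F : fieldType.
Implicit Types (x y z t : 'cV[F]_3) (U V : 'M[F]_3).

Definition indep3 x y z := forall a b c : F,
  a *: x + b *: y + c *: z = 0 -> [/\ a = 0, b = 0 & c = 0].

Definition mx3 x y z : 'M[F]_3 := \matrix_(i, j) (nth 0 [:: x; y; z] j) i 0.

Lemma mul_mx3 x y z (c : 'cV_3) : mx3 x y z *m c =
  c ord0 0 *: x + c (inord 1) 0 *: y + c (inord 2) 0 *: z.
Proof.
apply/matrixP => i j; rewrite !mxE !big_ord_recl big_ord0 addr0 ord1 !mxE /=.
have -> : lift ord0 ord0 = inord 1 :> 'I_3 by apply/val_inj; rewrite /= inordK.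
have -> : lift ord0 (lift ord0 ord0) = inord 2 :> 'I_3.
  by apply/val_inj; rewrite /= inordK.
by rewrite -addrA; congr (_ + (_ + _)); rewrite mulrC.
Qed.

Lemma indep3_unit x y z : indep3 x y z -> mx3 x y z \in unitmx.
Proof.
move=> ind; rewrite -unitmx_tr -row_free_unit -kermx_eq0 -nz_row_eq0.
set r := nz_row _.
have : mx3 x y z *m r^T = 0.
  apply/trmx_inj; rewrite trmx_mul trmxK trmx0; apply/eqP.
  by rewrite -sub_kermx nz_row_sub.
rewrite mul_mx3 => /ind[]; rewrite !mxE => r0 r1 r2.
apply/eqP/rowP => j; rewrite mxE; case: j => -[|[|[|//]]] lt_j.
- by rewrite -[RHS]r0; congr (_ _ _); apply/val_inj.
- by rewrite -[RHS]r1; congr (_ _ _); apply/val_inj; rewrite /= inordK.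
- by rewrite -[RHS]r2; congr (_ _ _); apply/val_inj; rewrite /= inordK.
Qed.

Lemma indep3_span x y z t : indep3 x y z ->
  exists a b c, t = a *: x + b *: y + c *: z.
Proof.
move=> ind; set c := invmx (mx3 x y z) *m t.
exists (c ord0 0), (c (inord 1) 0), (c (inord 2) 0); rewrite -mul_mx3.
by rewrite mulKVmx // indep3_unit.
Qed.

Lemma indep3_ext x y z U V : indep3 x y z ->
  U *m x = V *m x -> U *m y = V *m y -> U *m z = V *m z -> U = V.
Proof.
move=> ind Ex Ey Ez; apply: mulmx_ext => t.
have [a [b [c ->]]] := indep3_span t ind.
by rewrite !mulmxDr -!scalemxAr Ex Ey Ez.
Qed.

Lemma indep3_det x y z U a b c : indep3 x y z ->
  U *m x = a *: x -> U *m y = b *: y -> U *m z = c *: z -> \det U = a * b * c.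
Proof.
move=> ind Ux Uy Uz; pose d : 'rV_3 := \row_j nth 0 [:: a; b; c] j.
have E : U *m mx3 x y z = mx3 x y z *m diag_mx d.
  apply/trmx_inj/row_matrixP => i; rewrite -!tr_col; congr _^T.
  rewrite mul_mx_diag; apply/colP => k; rewrite !mxE.
  case: i => -[|[|[|//]]] lt_i; rewrite /= mulrC.
  - by have /colP/(_ k) := Ux; rewrite !mxE => <-; under eq_bigr do rewrite mxE.
  - by have /colP/(_ k) := Uy; rewrite !mxE => <-; under eq_bigr do rewrite mxE.
  - by have /colP/(_ k) := Uz; rewrite !mxE => <-; under eq_bigr do rewrite mxE.
have /(congr1 determinant) := E; rewrite !det_mulmx det_diag mulrC.
have Mu : \det (mx3 x y z) != 0 by rewrite -unitfE -unitmxE indep3_unit.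
by move/(mulfI Mu) ->; rewrite !big_ord_recl big_ord0 !mxE /= mulr1 mulrA.
Qed.

End ThreeVectors.

(** * Forms of signature (2,1) *)

Section Signature21.
Variables (C : numClosedFieldType) (H : 'M[C]_3).
Hypotheses (herm : H \is hermsymmx) (sgn : has_signature H 2 1).
Implicit Types (u v w x y z : 'cV[C]_3) (a b c k : C) (U V : 'M[C]_3).
Local Notation "[< x , y >]" := (hform H x y) (at level 0).

(** Being orthogonal to two vectors amounts to two linear equations in three
    unknowns. *)
Lemma common_orth u v : exists2 w, w != 0 & [<w, u>] = 0 /\ [<w, v>] = 0.
Proof.
pose M : 'M_(3, 1 + 1) := (col_mx (u^t* *m H) (v^t* *m H))^T.
have K0 : kermx M != 0.
  rewrite kermx_eq0 /row_free; apply/negP => /eqP rM.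
  by have := rank_leq_col M; rewrite rM.
exists (nz_row (kermx M))^T; first by rewrite trmx_eq0 nz_row_eq0.
have : (nz_row (kermx M))^T^T *m M = 0.
  by apply/eqP; rewrite trmxK -sub_kermx nz_row_sub.
move/(congr1 trmx); rewrite /M trmx_mul !trmxK mul_col_mx trmx0 => E.
split; [have := congr1 usubmx E | have := congr1 dsubmx E].
  by rewrite col_mxKu /hform => ->; rewrite !mxE.
by rewrite col_mxKd /hform => ->; rewrite !mxE.
Qed.

Lemma orth_sym x y : [<x, y>] = 0 -> [<y, x>] = 0.
Proof. by move=> xy; rewrite (hformC herm) xy rmorph0. Qed.

Lemma indep_orth w f u : [<w, w>] != 0 -> [<f, f>] != 0 -> u != 0 ->
  [<f, w>] = 0 -> [<w, u>] = 0 -> [<f, u>] = 0 -> indep3 w f u.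
Proof.
move=> ww ff u0 fw wu fu a b c E; have wf := orth_sym fw.
have a0 : a = 0.
  have /eqP := congr1 (hform H ^~ w) E.
  rewrite /= !hformE hform0l fw (orth_sym wu) !mulr0 !addr0 mulf_eq0 (negPf ww).
  by rewrite orbF => /eqP.
have b0 : b = 0.
  have /eqP := congr1 (hform H ^~ f) E.
  rewrite /= !hformE hform0l wf (orth_sym fu) !mulr0 addr0 add0r mulf_eq0.
  by rewrite (negPf ff) orbF => /eqP.
move: E; rewrite a0 b0 !scale0r !add0r => /eqP.
by rewrite scaler_eq0 (negPf u0) orbF => /eqP.
Qed.

Definition frame p q n :=
  [/\ [<p, p>] = 1, [<q, q>] = 1 & [<n, n>] = -1] /\
  [/\ [<p, q>] = 0, [<p, n>] = 0 & [<q, n>] = 0].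

Lemma frame_exists : exists p q n, frame p q n.
Proof.
have [P [d [_ Pd /eqP/cards2P[i [j [ij dij]]] /eqP/cards1P[k dk]]]] := sgn.
have gram l m : [<col l P, col m P>] = d 0 l *+ (m == l).
  have -> : d 0 l *+ (m == l) = (diag_mx d) m l.
    by rewrite mxE; case: eqP => [->|].
  rewrite -Pd /hform !colE trmx_mul map_mxM /= trmx_delta map_delta_mx.
  by rewrite -!mulmxA -rowE !mulmxA -colE !mxE.
have di : 0 < d 0 i by have /setP/(_ i) := dij; rewrite !inE eqxx.
have dj : 0 < d 0 j by have /setP/(_ j) := dij; rewrite !inE eqxx orbT.
have dk0 : d 0 k < 0 by have /setP/(_ k) := dk; rewrite !inE eqxx.
have ik : k != i by apply: contraTneq dk0 => ->; rewrite lt_gtF.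
have jk : k != j by apply: contraTneq dk0 => ->; rewrite lt_gtF.
pose s l := (sqrtC `|d 0 l|)^-1.
have scal l : d 0 l != 0 ->
    [<s l *: col l P, s l *: col l P>] = d 0 l / `|d 0 l|.
  move=> d0; rewrite !hformE gram eqxx mulr1n.
  have sR : (s l)^* = s l.
    by apply: CrealP; rewrite realV ger0_real // sqrtC_ge0.
  by rewrite sR mulrA -expr2 /s exprVn sqrtCK mulrC.
have orth l m : m != l -> [<s l *: col l P, s m *: col m P>] = 0.
  by move=> /negPf lm; rewrite !hformE gram lm !mulr0.
exists (s i *: col i P), (s j *: col j P), (s k *: col k P).
have d0 : [/\ d 0 i != 0, d 0 j != 0 & d 0 k != 0].
  by split; [apply: lt0r_neq0 | apply: lt0r_neq0 | apply: ltr0_neq0].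
have [di0 dj0 dk0'] := d0; split; split.
- by rewrite scal // gtr0_norm // divff.
- by rewrite scal // gtr0_norm // divff.
- by rewrite scal // ltr0_norm // invrN mulrN divff.
- by rewrite orth // eq_sym.
- by rewrite orth.
- by rewrite orth.
Qed.

Lemma frame_indep p q n : frame p q n -> indep3 p q n.
Proof.
move=> [[pp qq nn] [pq pn qn]].
apply: indep_orth => //; rewrite ?pp ?qq ?oner_eq0 //; last exact: orth_sym.
by apply: contra_eq_neq nn => ->; rewrite hform0l eq_sym oppr_eq0 oner_eq0.
Qed.

Lemma frame_hform p q n a b c a' b' c' : frame p q n ->
  [<a *: p + b *: q + c *: n, a' *: p + b' *: q + c' *: n>] =
  a * a'^* + b * b'^* - c * c'^*.
Proof.
move=> [[pp qq nn] [pq pn qn]]; rewrite !hformE pp qq nn pq pn qn.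
by rewrite (orth_sym pq) (orth_sym pn) (orth_sym qn); ring.
Qed.

(** In a frame, the coordinate of w along the negative vector is determined by
    the two others, and the Cauchy-Schwarz inequality in the plane bounds it. *)
Lemma neg_orth_pos n w : [<n, n>] < 0 -> [<w, n>] = 0 -> w != 0 -> 0 < [<w, w>].
Proof.
have [p0 [q0 [n0 fr]]] := frame_exists; have ind := frame_indep fr.
have [n1 [n2 [n3 ->]]] := indep3_span n ind.
have [w1 [w2 [w3 ->]]] := indep3_span w ind.
rewrite !frame_hform // -!normCK subr_lt0 => nneg /eqP.
rewrite subr_eq0 => /eqP wn w0.
have n3_gt0 : 0 < `|n3| ^+ 2.
  by apply: le_lt_trans nneg; rewrite addr_ge0 ?exprn_ge0.
have n3_neq0 : n3 != 0.
  by apply: contraTneq n3_gt0 => ->; rewrite normr0 expr0n ltxx.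
(* Lagrange's identity for (w1, w2) and (n1, n2), with w1 n1^* + w2 n2^*
   replaced by w3 n3^*; the right-hand side is positive. *)
have lagrange : (`|w1| ^+ 2 + `|w2| ^+ 2 - `|w3| ^+ 2) * `|n3| ^+ 2 =
    (`|w1| ^+ 2 + `|w2| ^+ 2) * (`|n3| ^+ 2 - (`|n1| ^+ 2 + `|n2| ^+ 2)) +
    `|w1 * n2 - w2 * n1| ^+ 2.
  have E : `|w3| ^+ 2 * `|n3| ^+ 2 =
      (w1 * n1^* + w2 * n2^*) * (w1^* * n1 + w2^* * n2).
    have -> : w1^* * n1 + w2^* * n2 = (w1 * n1^* + w2 * n2^*)^*.
      by rewrite rmorphD !rmorphM /= !conjCK.
    by rewrite wn -normCK normrM norm_conjC exprMn.
  rewrite mulrBl E !normCK rmorphB !rmorphM /=; ring.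
rewrite -(pmulr_lgt0 _ n3_gt0) lagrange.
apply: ltr_wpDr; first exact: exprn_ge0.
rewrite pmulr_lgt0 ?subr_gt0 // lt_def addr_ge0 ?exprn_ge0 // andbT.
apply: contra w0; rewrite paddr_eq0 ?exprn_ge0 // !sqrf_eq0 !normr_eq0.
case/andP=> /eqP w10 /eqP w20; move: wn.
rewrite w10 w20 !mul0r addr0 => /esym/eqP.
rewrite mulf_eq0 conjC_eq0 (negPf n3_neq0) orbF => /eqP ->.
by rewrite !scale0r !addr0.
Qed.

(** The component of w orthogonal to n has nonnegative square. *)
Lemma reverse_Cauchy_Schwarz n w :
  [<n, n>] < 0 -> [<w, w>] * [<n, n>] <= `|[<w, n>]| ^+ 2.
Proof.
move=> nn; pose w' := w - ([<w, n>] / [<n, n>]) *: n.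
have nn0 : [<n, n>] != 0 by rewrite lt_eqF.
have w'n : [<w', n>] = 0 by rewrite !hformE divfK // subrr.
have : 0 <= [<w', w'>].
  have [->|/(neg_orth_pos nn w'n)/ltW //] := eqVneq w' 0.
  by rewrite hform0l.
rewrite {2}/w' hformDr hformNr hformZr w'n mulr0 subr0 !hformE subr_ge0.
by rewrite [X in _ * X](hformC herm) mulrAC -normCK ler_ndivrMr.
Qed.

(** * Every nonscalar element is a product of four reflections *)

(** Equal squares and a real <x, u> make x + u orthogonal to x - u, so the
    reflection along x - u fixes x + u and negates x - u. *)
Lemma crefl_swap x u : [<x, x>] = [<u, u>] -> [<x, u>]^* = [<x, u>] ->
  [<x - u, x - u>] != 0 ->
  crefl H (x - u) (-1) *m x = u /\ crefl H (x - u) (-1) *m u = x.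
Proof.
move=> xxuu xuR w0; have ux : [<u, x>] = [<x, u>] by rewrite (hformC herm).
have ww : [<x - u, x - u>] = 2 * ([<x, x>] - [<x, u>]).
  by rewrite !hformE ux -xxuu; ring.
have d0 : [<x, x>] - [<x, u>] != 0.
  by apply: contraNneq w0; rewrite ww => ->; rewrite mulr0.
have xw : [<x, x - u>] = [<x, x>] - [<x, u>] by rewrite !hformE.
have uw : [<u, x - u>] = - ([<x, x>] - [<x, u>]).
  by rewrite !hformE ux -xxuu opprB.
have two : (2 : C) != 0 by rewrite pnatr_eq0.
rewrite !mul_crefl ww xw uw; split.
  have -> : (-1 - 1) * ([<x, x>] - [<x, u>]) / (2 * ([<x, x>] - [<x, u>])) = -1.
    by field; rewrite d0.
  by rewrite scaleN1r opprB addrC subrK.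
have -> : (-1 - 1) * - ([<x, x>] - [<x, u>]) / (2 * ([<x, x>] - [<x, u>])) = 1.
  by field; rewrite d0.
by rewrite scale1r addrC subrK.
Qed.

(** A totally isotropic subspace has dimension at most 1: otherwise it would
    meet the orthogonal of a negative vector, which is positive definite. *)
Lemma isotropic_orth x z : x != 0 -> [<x, x>] = 0 -> [<z, z>] = 0 ->
  [<x, z>] = 0 -> exists k, z = k *: x.
Proof.
move=> x0 xx zz xz; have [p [q [n [[_ _ nn] _]]]] := frame_exists.
have n_neg : [<n, n>] < 0 by rewrite nn ltrN10.
have xn0 : [<x, n>] != 0.
  by apply/eqP => xn; have := neg_orth_pos n_neg xn x0; rewrite xx ltxx.
exists ([<z, n>] / [<x, n>]); apply/eqP; rewrite -subr_eq0; apply/negPn/negP.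
move=> /(neg_orth_pos n_neg); rewrite !hformE divfK // subrr => /(_ erefl).
by rewrite zz xx (orth_sym xz) xz !(mulr0, subr0, addr0, oppr0, ltxx).
Qed.

Lemma isotropic_dual_neq0 x : x != 0 -> [<x, x>] = 0 -> x^t* *m H != 0.
Proof.
move=> x0 xx; have [p [q [n [[_ _ nn] _]]]] := frame_exists.
have n_neg : [<n, n>] < 0 by rewrite nn ltrN10.
apply/eqP => xH; have xn : [<x, n>] = 0.
  by apply: orth_sym; rewrite /hform xH mul0mx mxE.
by have := neg_orth_pos n_neg xn x0; rewrite xx ltxx.
Qed.

(** By unitarity, U acts on the quotient by the orthogonal of x as 1/r. Hence
    U - 1/r maps into that orthogonal and is singular. *)
Lemma dual_eigenvector U x r : isometry H U -> x != 0 -> [<x, x>] = 0 ->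
  U *m x = r *: x -> r != 0 -> r^* = r ->
  exists2 y : 'cV_3, y != 0 & U *m y = r^-1 *: y.
Proof.
move=> /isometryP isoU x0 xx Ux r0 rR.
have xU : (x^t* *m H) *m U = r^-1 *: (x^t* *m H).
  apply: (scalerI r0); rewrite scalerA divff // scale1r -[in RHS]isoU !mulmxA.
  have <- : (U *m x)^t* = x^t* *m U^t* by rewrite trmx_mul map_mxM.
  by rewrite Ux linearZ /= map_mxZ /= rR -!scalemxAl.
have : \det (U - r^-1%:M) == 0.
  apply/det0P; exists (x^t* *m H); first exact: isotropic_dual_neq0.
  by rewrite mulmxBr xU mul_mx_scalar subrr.
rewrite -det_tr => /det0P[y y0 yU]; exists y^T; first by rewrite trmx_eq0.
apply/eqP; rewrite -subr_eq0 -mul_scalar_mx -mulmxBl.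
by rewrite -trmx_eq0 trmx_mul trmxK yU.
Qed.

(** U has isotropic eigenvectors x and y, and the determinant condition forces
    it to fix their orthogonal.  One reflection exchanges x with y and the other
    one y with r x; their product is U. *)
Lemma real_eigenvalue_two_reflections U x r :
  isometry H U -> \det U = 1 -> x != 0 -> [<x, x>] = 0 ->
  U *m x = r *: x -> r != 0 -> r^* = r -> r * r != 1 ->
  exists v w, [/\ [<v, v>] != 0, [<w, w>] != 0 &
                 U = crefl H v (-1) *m crefl H w (-1)].
Proof.
move=> isoU detU x0 xx Ux r0 rR r1.
have [y0 y0_neq0 Uy0] := dual_eigenvector isoU x0 xx Ux r0 rR.
have y0y0 : [<y0, y0>] = 0.
  have /eqP := isoU y0 y0; rewrite Uy0 !hformE fmorphV /= rR mulrA -subr_eq0.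
  rewrite -[X in _ - X]mul1r -mulrBl mulf_eq0 subr_eq0 => /orP[|/eqP //].
  by rewrite -invfM invr_eq1 (negPf r1).
have xy0 : [<x, y0>] != 0.
  apply/eqP => /(isotropic_orth x0 xx y0y0)[k y0E]; case/negP: y0_neq0.
  have : (r - r^-1) *: y0 == 0.
    by rewrite scalerBl -Uy0 y0E -scalemxAr Ux !scalerA mulrC subrr.
  by rewrite scaler_eq0 subr_eq0 -(inj_eq (mulfI r0)) divff // (negPf r1).
have [y [xy yy Uy]] : exists y,
    [/\ [<x, y>] = 1, [<y, y>] = 0 & U *m y = r^-1 *: y].
  exists (([<x, y0>]^-1)^* *: y0); split.
  - by rewrite !hformE conjCK mulVf.
  - by rewrite !hformE y0y0 !mulr0.
  - by rewrite -scalemxAr Uy0 !scalerA mulrC.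
have yx : [<y, x>] = 1 by rewrite (hformC herm) xy rmorph1.
have [e e0 [ex ey]] := common_orth x y.
have [xe ye] := (orth_sym ex, orth_sym ey).
have ind : indep3 x y e.
  move=> a b c E.
  have a0 : a = 0.
    have := congr1 (hform H ^~ y) E; rewrite /= !hformE hform0l xy yy ey.
    by rewrite mulr1 !mulr0 !addr0.
  have b0 : b = 0.
    have := congr1 (hform H ^~ x) E; rewrite /= !hformE hform0l xx yx ex.
    by rewrite mulr1 !mulr0 !addr0 add0r.
  move: E; rewrite a0 b0 !scale0r !add0r => /eqP.
  by rewrite scaler_eq0 (negPf e0) orbF => /eqP.
have Ue : U *m e = e.
  have [a [b [c E]]] := indep3_span (U *m e) ind.
  have Uex : [<U *m e, x>] = 0.
    have /eqP := isoU e x; rewrite Ux hformE rR ex mulf_eq0 (negPf r0).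
    by move/eqP.
  have Uey : [<U *m e, y>] = 0.
    have /eqP := isoU e y; rewrite Uy hformE fmorphV /= rR ey mulf_eq0.
    by rewrite invr_eq0 (negPf r0) => /eqP.
  have a0 : a = 0.
    by move: Uey; rewrite E !hformE xy yy ey mulr1 !mulr0 !addr0.
  have b0 : b = 0.
    by move: Uex; rewrite E !hformE xx yx ex mulr1 !mulr0 addr0 add0r.
  move: E; rewrite a0 b0 !scale0r !add0r => E.
  have := indep3_det ind Ux Uy E; rewrite detU divff // mul1r => c1.
  by rewrite E -c1 scale1r.
have nn v w : [<v - w, v - w>] = [<v, v>] + [<w, w>] - [<v, w>] - [<w, v>].
  by rewrite !hformE; ring.
have two : (2 : C) != 0 by rewrite pnatr_eq0.
have w0 : [<x - y, x - y>] != 0.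
  by rewrite nn xx yy xy yx !add0r -opprD oppr_eq0.
have v0 : [<y - r *: x, y - r *: x>] != 0.
  rewrite nn !hformE xx yy xy yx rR !mulr0 !mulr1 !add0r -opprD oppr_eq0.
  by rewrite -mulr2n -mulr_natl mulf_neq0.
exists (y - r *: x), (x - y); split => //.
have [||//|Rx Ry] := @crefl_swap x y; rewrite ?xx ?yy ?xy ?rmorph1 //.
have [||//|Ry' Rx'] := @crefl_swap y (r *: x).
- by rewrite !hformE yy xx !mulr0.
- by rewrite hformE yx mulr1 conjCK rR.
apply: (indep3_ext ind).
- by rewrite Ux -mulmxA Rx Ry'.
- by rewrite Uy -mulmxA Ry -[in LHS]Rx' -scalemxAr scalerA mulVf // scale1r.
- by rewrite Ue -mulmxA !crefl_orth // !hformE ex ey ?mulr0 subrr.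
Qed.

(** Two reflections bring A x back to the line of x through an isotropic vector
    u.  The factor 1/2 is arbitrary: any real number other than 0, 1 and -1
    makes the previous lemma applicable to what remains. *)
Lemma four_reflections A x : isometry H A -> \det A = 1 -> [<x, x>] = 0 ->
  (forall k, A *m x != k *: x) ->
  exists v1 v2 v3 v4,
    [/\ [<v1, v1>] != 0, [<v2, v2>] != 0, [<v3, v3>] != 0 & [<v4, v4>] != 0] /\
    A = crefl H v1 (-1) *m crefl H v2 (-1) *m
        (crefl H v3 (-1) *m crefl H v4 (-1)).
Proof.
move=> isoA detA xx Ax; set z := A *m x.
have x0 : x != 0 by apply: contraNneq (Ax 0) => ->; rewrite mulmx0 scaler0.
have zz : [<z, z>] = 0 by rewrite isoA.
set g := [<x, z>].
have g0 : g != 0.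
  by apply/eqP => /(isotropic_orth x0 xx zz)[k /eqP]; apply/negP.
have zx : [<z, x>] = g^* by rewrite (hformC herm).
have [p p0 [px pz]] := common_orth x z.
have [xp zp] := (orth_sym px, orth_sym pz).
have pp : 0 < [<p, p>].
  apply: (@neg_orth_pos (x - g *: z)) => //.
    rewrite !hformE xx zz zx !(mulr0, add0r, addr0, subr0, oppr0).
    rewrite -/g -mulrC -normCK -opprD oppr_lt0.
    by rewrite addr_gt0 // exprn_gt0 ?normr_gt0.
  by rewrite !hformE px pz mulr0 subrr.
have pp0 : [<p, p>] != 0 by rewrite gt_eqF.
(* Whether <x, u> and <z, u> must have the same sign or opposite ones depends
   on the sign of Re (1/g). *)
have [eps [eps1 epsR eps_le]] : exists eps : C,
    [/\ eps != 0, eps^* = eps & eps * (g^-1 + (g^-1)^*) <= 0].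
  have gR : g^-1 + (g^-1)^* \is Num.real.
    by apply/CrealP; rewrite rmorphD /= conjCK addrC.
  have [ge0|/ltW le0] := real_leP (real0 C) gR.
    by exists (-1); rewrite oppr_eq0 oner_eq0 rmorphN rmorph1 mulN1r oppr_le0.
  by exists 1; rewrite oner_eq0 rmorph1 mul1r.
(* The coordinates of u on x and z are forced by the first two equations; they
   contribute a nonpositive real number to the third one, which a component
   along the positive vector p cancels. *)
have [u [xu zu uu]] :
    exists u, [/\ [<x, u>] = eps, [<z, u>] = 1 & [<u, u>] = 0].
  pose c := sqrtC (- (eps * (g^-1 + (g^-1)^*)) / [<p, p>]).
  have c_ge0 : 0 <= - (eps * (g^-1 + (g^-1)^*)) / [<p, p>].
    by rewrite divr_ge0 ?oppr_ge0 ?(ltW pp).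
  have cc : c * c^* = - (eps * (g^-1 + (g^-1)^*)) / [<p, p>].
    have -> : c^* = c by apply: CrealP; rewrite ger0_real // sqrtC_ge0.
    by rewrite -expr2 sqrtCK.
  have g0' : g^* != 0 by rewrite conjC_eq0.
  exists (g^-1 *: x + (eps / g^*) *: z + c *: p); rewrite !hformE; split.
  - rewrite xx xp -/g !mulr0 !(add0r, addr0) rmorphM /= fmorphV /= conjCK epsR.
    by rewrite divfK.
  - by rewrite zz zp zx !mulr0 !addr0 fmorphV /= mulVf.
  - rewrite xx zz xp zp px pz zx -/g !(mulr0, addr0, add0r).
    rewrite rmorphM /= !fmorphV /= conjCK epsR.
    rewrite [c * _]mulrA cc divfK // fmorphV /=; field; by rewrite g0 g0'.
have two : (2 : C) != 0 by rewrite pnatr_eq0.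
have two_conj : (2^-1 : C)^* = 2^-1 by rewrite fmorphV /= conjC_nat.
have ux : [<u, x>] = eps by rewrite (hformC herm) xu epsR.
have uz : [<u, z>] = 1 by rewrite (hformC herm) zu rmorph1.
have w0 : [<x - u, x - u>] != 0.
  rewrite !hformE xx uu xu ux !(oppr0, addr0, add0r) -opprD oppr_eq0.
  by rewrite -mulr2n -mulr_natl mulf_neq0.
have v0 : [<z - 2^-1 *: u, z - 2^-1 *: u>] != 0.
  rewrite !hformE zz uu zu uz two_conj !(mulr0, mulr1, oppr0, addr0, add0r).
  by rewrite -opprD oppr_eq0 -[2^-1]mul1r -splitr oner_eq0.
have [Rx Ru] : crefl H (x - u) (-1) *m x = u /\ crefl H (x - u) (-1) *m u = x.
  by apply: crefl_swap; rewrite ?xx ?uu ?xu.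
have [Rz _] : crefl H (z - 2^-1 *: u) (-1) *m z = 2^-1 *: u /\
    crefl H (z - 2^-1 *: u) (-1) *m (2^-1 *: u) = z.
  apply: crefl_swap => //; rewrite !hformE ?zz ?uu ?zu ?mulr0 // two_conj.
  by rewrite rmorphM rmorph1 /= two_conj.
set w := x - u in w0 Rx Ru; set v := z - 2^-1 *: u in v0 Rz.
have N1 : `|-1| = 1 :> C by rewrite normrN1.
have [] := @real_eigenvalue_two_reflections
  (crefl H w (-1) *m (crefl H v (-1) *m A)) x 2^-1.
- apply: isometryM; first exact: crefl_isometry.
  by apply: isometryM => //; exact: crefl_isometry.
- by rewrite !det_mulmx !det_crefl // detA mulr1 mulrNN mulr1.
- by [].
- by [].
- by rewrite -!mulmxA Rz -scalemxAr Ru.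
- by rewrite invr_eq0.
- by [].
- by rewrite -invfM invr_eq1 -natrM pnatr_eq1.
move=> v3 [v4 [v30 v40 E]]; exists v, w, v3, v4; split => //.
rewrite -E -!mulmxA [crefl H w _ *m (_ *m _)]mulmxA creflM // mulrNN mulr1.
by rewrite crefl1 mul1mx mulmxA creflM // mulrNN mulr1 crefl1 mul1mx.
Qed.

(** In a frame (p, q, n) the four isotropic vectors p + n, p - n, q + n and
    q - n span the space.  Comparing the two expressions of A n that they give
    shows that they all have the same eigenvalue. *)
Lemma scalar_of_isotropic A :
  (forall x, [<x, x>] = 0 -> exists k, A *m x = k *: x) ->
  exists k, A = k%:M.
Proof.
move=> eigA; have [p [q [n fr]]] := frame_exists.
have ind := frame_indep fr; have [[pp qq nn] [pq pn qn]] := fr.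
have isoD e : [<e, e>] = 1 -> [<e, n>] = 0 -> [<e + n, e + n>] = 0.
  by move=> ee en; rewrite !hformE ee nn en (orth_sym en); ring.
have isoB e : [<e, e>] = 1 -> [<e, n>] = 0 -> [<e - n, e - n>] = 0.
  by move=> ee en; rewrite !hformE ee nn en (orth_sym en); ring.
have [a Ea] := eigA _ (isoD p pp pn); have [b Eb] := eigA _ (isoB p pp pn).
have [c Ec] := eigA _ (isoD q qq qn); have [d Ed] := eigA _ (isoB q qq qn).
have [] := ind (a - b) (d - c) (a + b - c - d).
  transitivity (a *: (p + n) - b *: (p - n) - (c *: (q + n) - d *: (q - n))).
    by apply/colP => i; rewrite !mxE; ring.
  rewrite -Ea -Eb -Ec -Ed -!mulmxBr -[RHS](mulmx0 _ A); congr (A *m _).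
  by apply/colP => i; rewrite !mxE; ring.
move=> /subr0_eq ab /subr0_eq dc; rewrite -ab dc => E.
have two : (2 : C) != 0 by rewrite pnatr_eq0.
have ac : a = c.
  by apply: (mulfI two); apply: subr0_eq; rewrite -[RHS]E; ring.
move: Eb Ec Ed; rewrite -{}ab {}dc -{}ac => Eb Ec Ed.
exists a; apply: (indep3_ext ind); rewrite mul_scalar_mx; apply: (scalerI two).
- transitivity (A *m (p + n) + A *m (p - n)).
    by rewrite -mulmxDr scalemxAr;
    congr (A *m _); apply/colP => i; rewrite !mxE; ring.
  by rewrite Ea Eb; apply/colP => i; rewrite !mxE; ring.
- transitivity (A *m (q + n) + A *m (q - n)).
    by rewrite -mulmxDr scalemxAr;
    congr (A *m _); apply/colP => i; rewrite !mxE; ring.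
  by rewrite Ec Ed; apply/colP => i; rewrite !mxE; ring.
- transitivity (A *m (p + n) - A *m (p - n)).
    by rewrite -mulmxBr scalemxAr;
    congr (A *m _); apply/colP => i; rewrite !mxE; ring.
  by rewrite Ea Eb; apply/colP => i; rewrite !mxE; ring.
Qed.

(** * A complex reflection that is not a product of three reflections *)

(** Otherwise (w, f, u) would be an orthogonal basis of nonnegative vectors,
    and no vector would be negative. *)
Lemma orth_pos_pos_neg w f u : 0 < [<w, w>] -> 0 < [<f, f>] -> u != 0 ->
  [<f, w>] = 0 -> [<w, u>] = 0 -> [<f, u>] = 0 -> [<u, u>] < 0.
Proof.
move=> ww ff u0 fw wu fu.
have uR : [<u, u>] \is Num.real by apply/CrealP/hform_real.
have [uu|//] := real_leP (real0 C) uR.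
have ind := indep_orth (lt0r_neq0 ww) (lt0r_neq0 ff) u0 fw wu fu.
have [p [q [n [[_ _ nn] _]]]] := frame_exists.
have [a [b [c nE]]] := indep3_span n ind.
have : 0 <= [<n, n>].
  rewrite nE !hformE fw wu fu (orth_sym fw) (orth_sym wu) (orth_sym fu).
  rewrite !(mulr0, addr0, add0r) !mulrA -!normCK.
  by rewrite !addr_ge0 // mulr_ge0 ?exprn_ge0 // ltW.
by rewrite nn oppr_ge0 ler10.
Qed.

Lemma isometry_orth U x y a b : isometry H U -> U *m x = a *: x ->
  U *m y = b *: y -> a * b^* != 1 -> [<x, y>] = 0.
Proof.
move=> isoU Ux Uy ab; have /eqP := isoU x y; rewrite Ux Uy !hformE mulrA.
rewrite -subr_eq0 -[X in _ - X]mul1r -mulrBl mulf_eq0 subr_eq0 (negPf ab).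
by move/eqP.
Qed.

(** The ratios e1, e2 and e3 are 1 or -1, so that shorter products are included:
    a factor of ratio 1 is the identity. *)
Lemma not_three_reflections n k c v1 v2 v3 e1 e2 e3 :
    [<n, n>] < 0 -> `|k| = 1 -> k^* != k -> k + k^* < 0 ->
    [<v1, v1>] != 0 -> [<v2, v2>] != 0 -> [<v3, v3>] != 0 ->
    e1 * e1 = 1 -> e2 * e2 = 1 -> e3 * e3 = 1 ->
  crefl H n k <> c *: (crefl H v1 e1 *m crefl H v2 e2 *m crefl H v3 e3).
Proof.
move=> nn k1 kR k_neg v10 v20 v30 e11 e22 e33 E.
have sgnP (e : C) : e * e = 1 -> `|e| = 1 /\ e^* = e.
  move/eqP; rewrite -expr2 sqrf_eq1 => /orP[]/eqP->.
    by rewrite normr1 rmorph1.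
  by rewrite normrN1 rmorphN rmorph1.
have [[e1n e1R] [e2n e2R]] := (sgnP _ e11, sgnP _ e22).
have [e3n e3R] := sgnP _ e33.
have [e [en eR ee kE]] :
    exists e, [/\ `|e| = 1, e^* = e, e * e = 1 & k = c ^+ 3 * e].
  exists (e1 * e2 * e3); split.
  - by rewrite !normrM e1n e2n e3n !mulr1.
  - by rewrite !rmorphM /= e1R e2R e3R.
  - by rewrite mulrACA e33 mulr1 mulrACA e11 e22 mulr1.
  have := congr1 determinant E.
  by rewrite detZ !det_mulmx !det_crefl // lt_eqF.
have c1 : `|c| = 1.
  move: k1; rewrite kE normrM normrX en mulr1 => /eqP.
  by rewrite pexprn_eq1 // => /eqP.
have cc : c * c^* = 1 by rewrite -normCK c1 expr1n.
have cR : c^* != c.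
  by apply: contra kR => /eqP cR; rewrite kE rmorphM rmorphXn /= cR eR.
have c0 : c != 0 by rewrite -normr_eq0 c1 oner_eq0.
have sqr1 v e' : [<v, v>] != 0 -> e' * e' = 1 ->
    crefl H v e' *m crefl H v e' = 1%:M.
  by move=> v0 ee'; rewrite creflM // ee' crefl1.
have [R1K R2K] := (sqr1 _ _ v10 e11, sqr1 _ _ v20 e22).
have R3K := sqr1 _ _ v30 e33.
set B := crefl H v1 e1 *m crefl H v2 e2 in E.
have isoB : isometry H B by apply: isometryM; exact: crefl_isometry.
have AR : crefl H n k *m crefl H v3 e3 = c *: B.
  by rewrite E -scalemxAl -mulmxA R3K mulmx1.
(* The complex reflection along n and the one along v3 both fix w. *)
have [w w0 [wn wv3]] := common_orth n v3.
have ww : 0 < [<w, w>] by exact: neg_orth_pos nn wn w0.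
have Bw : B *m w = c^* *: w.
  have := congr1 (mulmx^~ w) AR; rewrite /= -mulmxA !crefl_orth // -scalemxAl.
  by move=> wE; rewrite [in RHS]wE scalerA mulrC cc scale1r.
(* The first reflection conjugates B to its inverse. *)
pose f := crefl H v1 e1 *m w.
have ff : 0 < [<f, f>] by rewrite crefl_isometry.
have Bf : B *m f = c *: f.
  have R2w : crefl H v2 e2 *m w = c^* *: f.
    by rewrite /f scalemxAr -Bw !mulmxA R1K mul1mx.
  rewrite /B -mulmxA [in RHS]/f scalemxAr; congr (_ *m _).
  apply: (scalerI (_ : c^* != 0)); first by rewrite conjC_eq0.
  by rewrite scalemxAr -R2w mulmxA R2K mul1mx scalerA mulrC cc scale1r.
have [u u0 [uv1 uv2]] := common_orth v1 v2.
have Bu : B *m u = 1 *: u by rewrite scale1r -mulmxA !crefl_orth.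
have fw : [<f, w>] = 0.
  apply: (isometry_orth isoB Bf Bw); rewrite conjCK -cc.
  by rewrite (inj_eq (mulfI c0)) eq_sym.
have c_neq1 : c != 1 by apply: contra cR => /eqP ->; rewrite rmorph1.
have wu : [<w, u>] = 0.
  apply: (isometry_orth isoB Bw Bu); rewrite rmorph1 mulr1.
  by rewrite -(inj_eq (can_inj conjCK)) conjCK rmorph1.
have fu : [<f, u>] = 0.
  by apply: (isometry_orth isoB Bf Bu); rewrite rmorph1 mulr1.
have uu : [<u, u>] < 0 by exact: orth_pos_pos_neg ww ff u0 fw wu fu.
have n0 : [<n, n>] != 0 by rewrite lt_eqF.
have R3u : crefl H v3 e3 *m u = c *: (crefl H n k^* *m u).
  have kk : k^* * k = 1 by rewrite mulrC -normCK k1 expr1n.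
  rewrite -[LHS]mul1mx -(crefl1 H n) -kk -creflM // -!mulmxA.
  rewrite [_ *m (_ *m u)]mulmxA.
  by rewrite AR -scalemxAl Bu scale1r -scalemxAr.
pose s := e * (c + c^*).
have [Q QE] : exists Q, Q = `|[<u, n>]| ^+ 2 / [<n, n>] by eexists.
have QR : Q^* = Q.
  rewrite QE rmorphM fmorphV /= hform_real // normCK rmorphM /= conjCK.
  by rewrite [X in X / _]mulrC.
have ck : c * k^* = e * c^* ^+ 2.
  rewrite kE rmorphM rmorphXn /= eR.
  by transitivity (c * c^* * (e * c^* ^+ 2)); [ring | rewrite cc mul1r].
have tE : [<crefl H v3 e3 *m u, u>] = c * [<u, u>] + (e * c^* ^+ 2 - c) * Q.
  rewrite R3u mul_crefl !hformE [[<n, u>]](hformC herm) -ck QE normCK.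
  by field.
(* The factor c - c^* splits off from the equation saying that the value in tE
   is real. *)
have uuE : [<u, u>] = Q * (1 + s).
  have := crefl_selfadj herm v3 u e3R; rewrite tE rmorphD !rmorphM /= QR.
  rewrite hform_real // rmorphB rmorphM rmorphXn /= conjCK eR => tR.
  apply: subr0_eq; apply: (mulfI (_ : c - c^* != 0)).
    by rewrite subr_eq0 eq_sym.
  move/eqP: tR; rewrite mulr0 eq_sym -subr_eq0 => /eqP <-.
  by rewrite /s; ring.
have Q_neg : Q < 0.
  rewrite QE ltr_ndivrMr // mul0r exprn_gt0 // normr_gt0; apply/eqP => un.
  by move: uu; rewrite uuE QE un normr0 expr0n /= mul0r mul0r ltxx.
have s_gt : 0 < 1 + s by rewrite -(nmulr_rlt0 _ Q_neg) -uuE.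
have s_le : s <= 0.
  rewrite -(nmulr_rge0 _ Q_neg); have := reverse_Cauchy_Schwarz u nn.
  rewrite -ler_ndivrMr // -QE uuE mulrDr mulr1.
  by rewrite lerDl.
(* With z = e c, of modulus 1, s = z + 1/z and k + 1/k = z^3 + 1/z^3. *)
have kkE : k + k^* = s * (s ^+ 2 - 3).
  rewrite kE rmorphM rmorphXn /= eR /s.
  transitivity (e * (c ^+ 3 + c^* ^+ 3)); first by ring.
  transitivity (e * ((c + c^*) ^+ 3 - 3 * (c * c^*) * (c + c^*))).
    by ring.
  rewrite cc.
  transitivity (e * (c + c^*) * ((e * e) * (c + c^*) ^+ 2 - 3)); last by ring.
  by rewrite ee; ring.
have : 0 <= k + k^*.
  rewrite kkE mulr_le0 // subr_le0 -sqrrN.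
  have s1 : - s <= 1 by rewrite lerNl -subr_ge0 opprK addrC ltW.
  by apply: le_trans (exprn_ile1 _ _ s1) _; rewrite ?oppr_ge0 ?ler1n.
by move=> k_ge0; have := le_lt_trans k_ge0 k_neg; rewrite ltxx.
Qed.

(** * From matrices to PU(2,1) *)

Lemma norm_expr_eq1 a m : `|a ^+ m.+1| = 1 -> `|a| = 1.
Proof. by rewrite normrX => /eqP; rewrite pexprn_eq1 // => /eqP. Qed.

Lemma detH_neq0 : \det H != 0.
Proof.
apply/det0P => -[v v0 vH].
have xH : (v^t*)^t* *m H = 0 by rewrite trmxCK.
have x0 : v^t* != 0.
  by apply: contraNneq v0 => x0; rewrite -[v]trmxCK x0 trmx0 map_mx0.
have xx : [<v^t*, v^t*>] = 0 by rewrite /hform xH mul0mx mxE.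
by have := isotropic_dual_neq0 x0 xx; rewrite xH eqxx.
Qed.

Lemma det_isometry U : isometry H U -> `|\det U| = 1.
Proof.
move=> /isometryP /(congr1 determinant); rewrite !det_mulmx det_map_mx det_tr.
rewrite mulrAC -[RHS]mul1r => /(mulIf detH_neq0); rewrite mulrC -normCK => /eqP.
by rewrite sqrp_eq1 // => /eqP.
Qed.

Lemma isometry_unit U : isometry H U -> U \in unitmx.
Proof.
by move=> isoU; rewrite unitmxE unitfE -normr_eq0 det_isometry ?oner_eq0.
Qed.

(** B is unitary and involutive, hence self-adjoint, and so is E = 1 - B, which
    has rank 1 and satisfies E^2 = 2 E.  Its image is thus spanned by some v
    with E v = 2 v, and E x is determined by 2 <x, v> = <E x, v>.  If v were
    isotropic, this relation would put it in the radical of the form. *)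
Lemma isometry_involution B : isometry H B -> B *m B = 1%:M ->
  \rank (1%:M - B) = 1%N ->
  exists2 v, [<v, v>] != 0 & B = crefl H v (-1).
Proof.
move=> isoB BB rk; set E := 1%:M - B in rk.
have adj x y : [<B *m x, y>] = [<x, B *m y>].
  by rewrite -isoB mulmxA BB mul1mx.
have adjE x y : [<E *m x, y>] = [<x, E *m y>].
  by rewrite !mulmxBl !mul1mx !hformE adj.
have [r rE r0] : exists2 r : 'rV_3, (r <= E^T)%MS & r != 0.
  exists (nz_row E^T); first exact: nz_row_sub.
  by rewrite nz_row_eq0 -mxrank_eq0 mxrank_tr rk.
have rE' : (E^T <= r)%MS.
  by rewrite -(mxrank_leqif_sup rE).2 mxrank_tr rk rank_rV r0.
pose v := r^T; have v0 : v != 0 by rewrite trmx_eq0.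
have Ek x : exists k, E *m x = k *: v.
  have /sub_rVP[k kE] : (x^T *m E^T <= r)%MS.
    by rewrite (submx_trans (submxMl _ _)).
  by exists k; apply: trmx_inj; rewrite trmx_mul kE linearZ /= trmxK.
have Ev : E *m v = 2 *: v.
  have /submxP[y yE] := rE.
  have -> : v = E *m y^T by rewrite /v yE trmx_mul trmxK.
  rewrite mulmxA scalemxAl; congr (_ *m _).
  rewrite mulmxBl mul1mx mulmxBr mulmx1 BB opprB.
  by rewrite scaler_nat mulr2n.
have two : (2 : C) != 0 by rewrite pnatr_eq0.
have Exv x : 2 * [<x, v>] = [<E *m x, v>].
  by rewrite adjE Ev hformZr conjC_nat.
have vv0 : [<v, v>] != 0.
  apply/eqP => vv; have xv x : [<x, v>] = 0.
    apply: (mulfI two); rewrite Exv mulr0; have [k ->] := Ek x.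
    by rewrite hformZl vv mulr0.
  have [p [q [n [[_ _ nn] _]]]] := frame_exists.
  have n_neg : [<n, n>] < 0 by rewrite nn ltrN10.
  by have := neg_orth_pos n_neg (orth_sym (xv n)) v0; rewrite vv ltxx.
exists v => //; apply: mulmx_ext => x; rewrite mul_crefl.
have [k kE] := Ek x; have -> : B *m x = x - k *: v.
  by rewrite -kE mulmxBl mul1mx opprB addrC subrK.
rewrite -scaleNr; congr (_ + _ *: _).
have := Exv x; rewrite kE hformZl => xv; apply: (mulIf vv0).
by rewrite divfK // mulNr -xv; ring.
Qed.

(** Relating the abstract quotient to unitary matrices: [lifts_eq] says that the
    matrix of an element is determined up to a scalar, so equations in PU(2,1)
    become equations up to a scalar between matrices. *)
Definition lifts U (x : PU H) :=
  isometry H U /\ exists2 A : GL C 3, (A : 'M_3) = U & val x = pgl_proj A.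

Lemma lifts_ex U : isometry H U -> exists x : PU H, lifts U x.
Proof.
move=> isoU; pose A := MkGL (isometry_unit isoU).
have PA : PU_pred H (pgl_proj A).
  by apply/asboolP; exists A => //; rewrite inE; apply/eqP/isometryP.
by exists (exist _ (pgl_proj A) PA); split => //; exists A.
Qed.

Lemma ex_lifts (x : PU H) : exists U, lifts U x.
Proof.
have /asboolP[A uA xA] := valP x; exists A; split; last by exists A.
by apply/isometryP/eqP; rewrite inE in uA.
Qed.

Lemma lifts1 : lifts 1%:M 1%g.
Proof.
split; first by move=> x y; rewrite !mul1mx.
by exists 1%g.
Qed.

Lemma liftsM U V (x y : PU H) :
  lifts U x -> lifts V y -> lifts (U *m V) (x * y)%g.
Proof.
move=> [isoU [A AU xA]] [isoV [B BV yB]]; split; first exact: isometryM.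
by exists (A * B)%g; [rewrite -AU -BV | rewrite pgl_projM -xA -yB].
Qed.

Lemma lifts_eq U V (x y : PU H) : lifts U x -> lifts V y ->
  x = y <-> exists c, U = c *: V.
Proof.
move=> [_ [A <- xA]] [_ [B <- yB]]; rewrite -pgl_projP -xA -yB.
by split=> [->|/val_inj].
Qed.

(** A lift is divided by a cube root of its determinant. *)
Lemma lifts_det1 (x : PU H) : exists2 U, lifts U x & \det U = 1.
Proof.
have [U Ux] := ex_lifts x; have isoU := Ux.1.
set a := 3.-root (\det U).
have a3 : a ^+ 3 = \det U by rewrite rootCK.
have a1 : `|a| = 1.
  by apply: (@norm_expr_eq1 a 2); rewrite a3 det_isometry.
have a0 : a != 0 by rewrite -normr_eq0 a1 oner_eq0.
have isoV : isometry H (a^-1 *: U).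
  by apply: isometryZ => //; rewrite normfV a1 invr1.
have [y Vy] := lifts_ex isoV; exists (a^-1 *: U).
  suff -> : x = y by [].
  by apply/(lifts_eq Ux Vy); exists a; rewrite scalerA divff // scale1r.
by rewrite detZ exprVn a3 mulVf // -a3 expf_neq0.
Qed.

Lemma lifts_involution v (x : PU H) :
  [<v, v>] != 0 -> lifts (crefl H v (-1)) x -> involution x.
Proof.
move=> v0 vx; apply/andP; split.
  apply/eqP => /(lifts_eq vx lifts1)[c E].
  have [w w0 [wv _]] := common_orth v v.
  have := congr1 (mulmx^~ w) E; rewrite /= crefl_orth // -scalemxAl mul1mx.
  move/eqP; rewrite -subr_eq0 -[X in X - _]scale1r -scalerBl scaler_eq0.
  rewrite (negPf w0) orbF subr_eq0 => /eqP c1.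
  have := congr1 (mulmx^~ v) E; rewrite /= crefl_id // -c1 scale1r mul1mx.
  move/eqP; rewrite -subr_eq0 -[X in _ - X]scale1r -scalerBl scaler_eq0.
  rewrite -opprD oppr_eq0 -[1 + 1]/(2%:R) pnatr_eq0 /= => /eqP v00.
  by move: v0; rewrite v00 hform0l eqxx.
rewrite expgS expg1; apply/eqP/(lifts_eq (liftsM vx vx) lifts1).
by exists 1; rewrite creflM // mulrNN mulr1 crefl1 scale1r.
Qed.

(** A lift squares to a scalar c; divided by a square root of c it becomes a
    unitary involution B.  As (1 - B) (1 + B) = 0 with both factors nonzero, one
    of them has rank 1, and B or -B is a reflection. *)
Lemma involution_lifts (x : PU H) : involution x ->
  exists2 v, [<v, v>] != 0 & lifts (crefl H v (-1)) x.
Proof.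
case/andP => x1; rewrite expgS expg1 => /eqP xx.
have [U Ux] := ex_lifts x; have isoU := Ux.1.
have [c UU] := (lifts_eq (liftsM Ux Ux) lifts1).1 xx.
set a := sqrtC c.
have a2 : a ^+ 2 = c by rewrite sqrtCK.
have a1 : `|a| = 1.
  have := det_isometry isoU => d1; have := congr1 determinant UU.
  rewrite det_mulmx detZ det1 mulr1 -a2 => /(congr1 Num.norm).
  rewrite normrM d1 mulr1 -exprM => /esym; exact: norm_expr_eq1.
have a0 : a != 0 by rewrite -normr_eq0 a1 oner_eq0.
set B := a^-1 *: U.
have isoB : isometry H B by apply: isometryZ => //; rewrite normfV a1 invr1.
have BB : B *m B = 1%:M.
  rewrite -scalemxAl -scalemxAr UU !scalerA -a2 -invfM -expr2.
  by rewrite mulVf ?expf_neq0 // scale1r.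
have not_scalar k : B != k%:M.
  apply: contra x1 => /eqP BE; apply/eqP/(lifts_eq Ux lifts1); exists (a * k).
  by rewrite -scalerA scalemx1 -BE scalerA divff // scale1r.
have concl s : s * s = 1 -> \rank (1%:M - s *: B) = 1%N ->
    exists2 v, [<v, v>] != 0 & lifts (crefl H v (-1)) x.
  move=> ss rk.
  have s1 : `|s| = 1.
    by apply: (@norm_expr_eq1 s 1); rewrite expr2 ss normr1.
  have [] := @isometry_involution (s *: B) _ _ rk.
  - exact: isometryZ.
  - by rewrite -scalemxAl -scalemxAr BB scalerA ss scale1r.
  move=> v v0 sB; exists v => //.
  have isov : isometry H (crefl H v (-1)).
    by apply: crefl_isometry; rewrite ?normrN1.
  have [y vy] := lifts_ex isov; suff -> : x = y by [].
  apply/(lifts_eq Ux vy); exists (a * s).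
  by rewrite -sB scalerA -mulrA ss mulr1 scalerA divff // scale1r.
have rkP : (0 < \rank (1%:M - B)%R)%N.
  rewrite lt0n mxrank_eq0 subr_eq0 eq_sym; exact: not_scalar.
have rkN : (0 < \rank (1%:M + B)%R)%N.
  rewrite lt0n mxrank_eq0 addrC addr_eq0 -scaleN1r scalemx1; exact: not_scalar.
have rkle : (\rank (1%:M - B)%R + \rank (1%:M + B)%R <= 3)%N.
  apply: mulmx0_rank_max; rewrite mulmxDr mulmx1 mulmxBl mul1mx BB.
  by rewrite addrA subrK subrr.
have [rk1|rk1] := eqVneq (\rank (1%:M - B)) 1%N.
  by apply: (concl 1); rewrite ?mulr1 // scale1r.
apply: (concl (-1)); rewrite ?mulrNN ?mulr1 // scaleN1r opprK.
apply/eqP; rewrite eqn_leq rkN andbT -(leq_add2l 2); apply: leq_trans rkle.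
by rewrite leq_add2r ltn_neqAle eq_sym rk1.
Qed.

Lemma prod_of_four (x : PU H) : prod_of_involutions 4 x.
Proof.
have [U Ux detU] := lifts_det1 x; have isoU := Ux.1.
have [eigU|/existsNP[y /not_implyP[yy noeig]]] :=
  pselect (forall y, [<y, y>] = 0 -> exists k, U *m y = k *: y).
  have [k Uk] := scalar_of_isotropic eigU; exists [::]; split=> //.
  by rewrite big_nil; apply/(lifts_eq Ux lifts1); exists k; rewrite scalemx1.
have Uy k : U *m y != k *: y by apply/eqP => Uyk; apply: noeig; exists k.
have [v1 [v2 [v3 [v4 [[n1 n2 n3 n4] UE]]]]] := four_reflections isoU detU yy Uy.
have lift v : [<v, v>] != 0 ->
    exists2 g : PU H, involution g & lifts (crefl H v (-1)) g.
  move=> v0; have isov : isometry H (crefl H v (-1)).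
    by apply: crefl_isometry; rewrite ?normrN1.
  by have [g vg] := lifts_ex isov; exists g => //; exact: lifts_involution vg.
have [[g1 i1 l1] [g2 i2 l2]] := (lift _ n1, lift _ n2).
have [[g3 i3 l3] [g4 i4 l4]] := (lift _ n3, lift _ n4).
exists [:: g1; g2; g3; g4]; split=> //; first by rewrite /= i1 i2 i3 i4.
rewrite !big_cons big_nil mulg1 [(g1 * _)%g]mulgA.
apply/(lifts_eq Ux (liftsM (liftsM l1 l2) (liftsM l3 l4))).
by exists 1; rewrite scale1r.
Qed.

Lemma unit_nonreal_neg : exists k : C, [/\ `|k| = 1, k^* != k & k + k^* < 0].
Proof.
have five : (5 : C) != 0 by rewrite pnatr_eq0.
have kC : ((-3 + 4 * 'i) / 5 : C)^* = (-3 - 4 * 'i) / 5.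
  by rewrite rmorphM fmorphV rmorphD rmorphN rmorphM /= !conjC_nat conjCi mulrN.
have ii : 'i * 'i = -1 :> C by rewrite -expr2 sqrCi.
exists ((-3 + 4 * 'i) / 5); rewrite kC; split.
- apply/eqP; rewrite -sqrp_eq1 // normCK kC; apply/eqP.
  transitivity ((9 - 16 * ('i * 'i)) / 25 : C); first by field.
  by rewrite ii; field.
- apply/eqP => /(mulIf (invr_neq0 five)) /addrI /eqP.
  rewrite -subr_eq0 -opprD oppr_eq0 -mulrDl -natrD mulf_eq0 pnatr_eq0 /=.
  exact/negP/neq0Ci.
- have -> : (-3 + 4 * 'i) / 5 + (-3 - 4 * 'i) / 5 = - (6 / 5) :> C by field.
  by rewrite oppr_lt0 divr_gt0 ?ltr0n.
Qed.

(** A list of at most three involutions is padded to length 3 by the identity,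
    the complex reflection of ratio 1 along any nonisotropic vector. *)
Lemma not_prod_of_three : exists x : PU H, ~ prod_of_involutions 3 x.
Proof.
have [p [q [n [[_ _ nn] _]]]] := frame_exists.
have n_neg : [<n, n>] < 0 by rewrite nn ltrN10.
have n0 : [<n, n>] != 0 by rewrite lt_eqF.
have [k [k1 kR k_neg]] := unit_nonreal_neg.
have [x kx] := lifts_ex (crefl_isometry herm k1 n0).
exists x => -[s [s3 /allP s_inv xE]].
have one_or (y : PU H) : y \in 1%g :: s ->
    exists v e, [/\ [<v, v>] != 0, e * e = 1 & lifts (crefl H v e) y].
  rewrite inE => /orP[/eqP->|/s_inv/involution_lifts[v v0 vy]].
    by exists n, 1; rewrite mulr1 crefl1; split=> //; exact: lifts1.
  by exists v, (-1); rewrite mulrNN mulr1.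
have s_nth i : nth 1%g s i \in 1%g :: s.
  have [i_s|s_i] := ltnP i (size s); first by rewrite inE mem_nth ?orbT.
  by rewrite nth_default // mem_head.
have x3 : x = (nth 1%g s 0 * nth 1%g s 1 * nth 1%g s 2)%g.
  rewrite xE; case: (s) s3 => [|a [|b [|c [|]]]] //= _;
  by rewrite !(big_cons, big_nil) ?mulg1 ?mulgA.
have [v1 [e1 [v10 e11 l1]]] := one_or _ (s_nth 0).
have [v2 [e2 [v20 e22 l2]]] := one_or _ (s_nth 1).
have [v3 [e3 [v30 e33 l3]]] := one_or _ (s_nth 2).
have [c E] := (lifts_eq kx (liftsM (liftsM l1 l2) l3)).1 x3.
exact: not_three_reflections E.
Qed.

End Signature21.

Theorem theorem1 (R : realType) (H : 'M[R[i]]_3)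
    (herm : H \is hermsymmx) (sgn : has_signature H 2 1) :
  has_involution_length (PU H) 4 /\
  (forall x : PU H, prod_of_involutions 4 x) /\
  (exists x : PU H, ~ prod_of_involutions 3 x).
Proof.
have four := prod_of_four herm sgn; have [x not3] := not_prod_of_three herm sgn.
split; last by split=> //; exists x.
split=> // m m_inv; rewrite leqNgt; apply/negP => m4; apply: not3.
have [s [s_m s_inv xE]] := m_inv x; exists s; split=> //.
by apply: leq_trans s_m _; rewrite -ltnS.
Qed.
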